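(* Let $n$ be a positive integer and let $f(x)=x^3+bx+a^n$, where $a,b$ are co-prime integers with $a>0$ and $b\neq 0$. If $\mathbb{Q}$ is a splitting field for $f(x)$, then there exist positive integers $p,q,r$ such that $a=pqr$ and $(X,Y,Z)=(p,q,r)$ is a solution of the equation $X^n+Y^n=Z^n$ with $X,Y,Z$ pairwise co-prime. Conversely, if there exist positive integers $p,q,r$ which are a solution $(X,Y,Z)=(p,q,r)$ of $X^n+Y^n=Z^n$ with $X,Y,Z$ pairwise co-prime, then there exists a polynomial $f(x)=x^3+bx+a^n$ with $a=pqr$, an integer $b\neq 0$ and $\gcd(a,b)=1$, such that $\mathbb{Q}$ is its splitting field.
   Context: ''$\mathbb{Q}$ is a splitting field for $f(x)$'' means that $f(x)$ factors as a product of linear factors over $\mathbb{Q}$. *)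

(* Defs.v *)
From mathcomp Require Import all_boot all_order all_algebra.

Set Implicit Arguments.
Unset Strict Implicit.
Unset Printing Implicit Defensive.

Import Order.TTheory GRing.Theory Num.Theory.

Local Open Scope ring_scope.

(* [F] is a splitting field for [p], where [p] has coefficients in [F] itself:
   the linear factors are the polynomials of size 2, and are not required to
   be monic. *)
Definition is_splitting_field (F : fieldType) (p : {poly F}) : Prop :=
  exists2 s : seq {poly F},
    (forall g, g \in s -> size g = 2%N) & p = \prod_(g <- s) g.

Definition trinomial (n : nat) (a b : int) : {poly rat} :=
  'X^3 + b%:~R *: 'X + (a%:~R ^+ n)%:P.

Definition coprime_fermat_solution (n : nat) (p q r : int) : Prop :=
  [/\ [/\ 0 < p, 0 < q & 0 < r],
      p ^+ n + q ^+ n = r ^+ n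
    & [/\ coprimez p q, coprimez p r & coprimez q r]].

(* Main.v *)
(* The roots of a split f are integers u, v, w with u + v + w = 0,
   uv + uw + vw = b and uvw = -a^n. Modulo u the first two give b = -v^2, so
   gcd(a, b) = 1 makes the roots pairwise coprime. As uvw < 0 and u + v + w = 0,
   exactly one root, say w, is negative, and u * v * (u + v) = a^n with pairwise
   coprime positive factors: each is an n-th power, and these n-th powers solve
   Fermat's equation. Conversely p^n, q^n and -r^n serve as roots. *)
Require Import Defs.
From mathcomp Require Import all_boot all_order all_algebra.
From mathcomp Require Import ring zify.

Set Implicit Arguments.
Unset Strict Implicit.
Unset Printing Implicit Defensive.

Import Order.TTheory GRing.Theory Num.Theory.

Local Open Scope ring_scope.

(** Dividing both numbers by their gcd leaves coprime cofactors, whose powers stay coprime. The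
    division needs a nonzero gcd, hence the separate case [m = c = 0]. *)
Lemma gcdnX (m c n : nat) : (gcdn (m ^ n) (c ^ n) = gcdn m c ^ n)%N.
Proof.
have [g0|g0] := posnP (gcdn m c).
  have [-> ->] : m = 0%N /\ c = 0%N by have := gcdn_gt0 m c; rewrite g0; lia.
  by rewrite !gcdnn.
have [m' em] := dvdnP (dvdn_gcdl m c); have [c' ec] := dvdnP (dvdn_gcdr m c).
set g := gcdn m c in g0 em ec *.
have co : coprime m' c' by rewrite /coprime -(eqn_pmul2r g0) muln_gcdl -em -ec mul1n.
rewrite em ec !expnMn -muln_gcdl.
by move: (coprimeXl n (coprimeXr n co)) => /eqP ->; rewrite mul1n.
Qed.

(** With [c ^ n = m * k] and [n] positive, a factor [m] comes out of both arguments: gcd(m, c)^n =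
    gcd(m^n, m k) = m gcd(m^(n-1), k) = m. *)
Lemma coprime_mul_expn (m k c n : nat) :
  (0 < n)%N -> coprime m k -> (m * k = c ^ n)%N -> m = (gcdn m c ^ n)%N.
Proof.
case: n => // n _ co e; rewrite -gcdnX -e expnS -muln_gcdr.
by move: (coprimeXl n co) => /eqP ->; rewrite muln1.
Qed.

Lemma coprimez_mul_exprn (m k c : int) (n : nat) :
    (0 < n)%N -> 0 < m -> coprimez m k -> m * k = c ^+ n ->
  exists2 p : int, 0 < p & m = p ^+ n.
Proof.
move=> n0 m0 co e; exists (gcdz m c).
  by rewrite /gcdz ltz_nat gcdn_gt0 absz_gt0 gt_eqF.
rewrite -[LHS]gtz0_abs // (@coprime_mul_expn `|m| `|k| `|c| n) //.
  by rewrite -natz natrX natz.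
by rewrite -abszM e abszX.
Qed.

Lemma coprimezMDl (u v k : int) :
  coprimez u (k * u + v) = coprimez u v.
Proof. by rewrite /coprimez gcdzMDl. Qed.

Lemma coprimez_sum_prod_eq_exp (n : nat) (u v a : int) :
    (0 < n)%N -> 0 < a -> 0 < u -> 0 < v -> coprimez u v ->
    u * v * (u + v) = a ^+ n ->
  exists p q r : int, a = p * q * r /\ coprime_fermat_solution n p q r.
Proof.
move=> n0 a0 u0 v0 uv e.
have uw : coprimez u (u + v) by rewrite -[X in X + v]mul1r coprimezMDl.
have vw : coprimez v (u + v).
  by rewrite addrC -[X in X + u]mul1r coprimezMDl coprimez_sym.
have vu : coprimez v u by rewrite coprimez_sym.
have wu : coprimez (u + v) u by rewrite coprimez_sym.
have wv : coprimez (u + v) v by rewrite coprimez_sym.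
have [p p0 up] : exists2 p : int, 0 < p & u = p ^+ n.
  apply: (@coprimez_mul_exprn _ (v * (u + v)) a) => //.
    by rewrite coprimezMr uv.
  by rewrite mulrA.
have [q q0 vq] : exists2 q : int, 0 < q & v = q ^+ n.
  apply: (@coprimez_mul_exprn _ (u * (u + v)) a) => //.
    by rewrite coprimezMr vu.
  by rewrite -e; ring.
have [r r0 wr] : exists2 r : int, 0 < r & u + v = r ^+ n.
  apply: (@coprimez_mul_exprn _ (u * v) a) => //.
  - exact: addr_gt0.
  - by rewrite coprimezMr wu.
  - by rewrite -e; ring.
exists p, q, r; split.
  (* Raising to a positive power is injective on nonnegative integers, so it suffices that a^n =
     (pqr)^n. *)
  apply/eqP; rewrite -(@eqrXn2 _ n) // ?ltW ?mulr_gt0 //.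
  by rewrite !exprMn -up -vq -wr e.
split=> //; first by rewrite -up -vq.
move: uv uw vw; rewrite wr {1 2}up vq.
by rewrite !coprimez_pexpl // !coprimez_pexpr.
Qed.

(** The rational root test: the denominator divides the cube of the numerator and is coprime to it,
    so it is 1. *)
Lemma rat_root_cubic_int (x : rat) (b c : int) :
  x ^+ 3 + b%:~R * x + c%:~R = 0 -> exists z : int, x = z%:~R.
Proof.
move=> e; exists (numq x).
have : (denq x %| numq x ^+ 3)%Z.
  (* For x = N/D, multiplying the equation by D^3 gives N^3 = -(b N D + c D^2) D. *)
  apply/dvdzP; exists (- (b * numq x * denq x + c * denq x ^+ 2)).
  apply: (@intr_inj rat) => /=.
  rewrite !(rmorphM, rmorphN, rmorphD, rmorphXn) /= numqE.
  by apply/eqP; rewrite -subr_eq0 -(mulr0 ((denq x)%:~R ^+ 3)) -e; apply/eqP; ring.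
rewrite -[numq x ^+ 3]mulr1 Gauss_dvdzr; last first.
  by apply: coprimezXr; rewrite coprimez_sym; exact: coprime_num_den.
rewrite dvdz1 => /eqP d1; rewrite numqE.
have -> : denq x = 1 by rewrite -absz_denq d1.
by rewrite mulr1.
Qed.

Lemma size2_poly_factor (F : fieldType) (g : {poly F}) :
  size g = 2%N -> exists c x : F, g = c *: ('X - x%:P).
Proof.
move=> sg; exists g`_1, (- g`_0 / g`_1).
have g1 : g`_1 != 0.
  by have := lead_coef_eq0 g; rewrite lead_coefE sg /= -size_poly_eq0 sg => ->.
apply/polyP => i; rewrite coefZ coefB coefX coefC.
case: i => [|[|i]] /=.
- by rewrite sub0r mulNr opprK mulrCA mulfV ?mulr1.
- by rewrite subr0 mulr1.
- by rewrite subr0 mulr0 nth_default // sg.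
Qed.

Lemma trinomial_coefs (n : nat) (a b : int) (i : nat) :
  (trinomial n a b)`_i =
    (i == 3)%:R + b%:~R * (i == 1)%:R + (if i == 0%N then a%:~R ^+ n else 0).
Proof. by rewrite /trinomial !coefD coefXn coefZ coefX coefC. Qed.

Lemma splitting_monic_cubic (F : fieldType) (f : {poly F}) :
    f \is monic -> size f = 4%N -> is_splitting_field f ->
  exists x y z : F, f = ('X - x%:P) * ('X - y%:P) * ('X - z%:P).
Proof.
move=> fm sf [s s2 fs].
have : size s = 3%N.
  move: sf; rewrite fs size_prod_seq; last first.
    by move=> g gs; rewrite -size_poly_eq0 s2.
  (* A product of k factors of size 2 has size k + 1, so size 4 forces k = 3. *)
  rewrite (eq_big_seq (fun=> 2%N)) //.
  rewrite big_const_seq count_predT iter_addn addn0.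
  by move: (size s) => k; lia.
case: s s2 fs => [|g1 [|g2 [|g3 [|]]]] //= s2 fs _.
have [c1 [x1 e1]] := size2_poly_factor (s2 g1 (mem_head _ _)).
have [c2 [x2 e2]] : exists c x, g2 = c *: ('X - x%:P).
  by apply: size2_poly_factor; apply: s2; rewrite !inE eqxx orbT.
have [c3 [x3 e3]] : exists c x, g3 = c *: ('X - x%:P).
  by apply: size2_poly_factor; apply: s2; rewrite !inE eqxx !orbT.
have e : f = (c1 * c2 * c3) *: (('X - x1%:P) * ('X - x2%:P) * ('X - x3%:P)).
  rewrite fs !big_cons big_nil mulr1 e1 e2 e3.
  by rewrite -!mul_polyC !polyCM; ring.
(* The factors need not be monic, but the product of their leading coefficients is that of [f],
   namely 1. *)
exists x1, x2, x3; rewrite e.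
move: fm; rewrite monicE e lead_coefZ !lead_coefM !lead_coefXsubC !mulr1 => /eqP ->.
by rewrite scale1r.
Qed.

Lemma cubic_prodE (R : comNzRingType) (x y z : R) :
  ('X - x%:P) * ('X - y%:P) * ('X - z%:P) =
  'X^3 - (x + y + z) *: 'X^2 + (x * y + x * z + y * z) *: 'X - (x * y * z)%:P.
Proof. by rewrite -!mul_polyC !polyCD !polyCM; ring. Qed.

Lemma trinomial_eq_prod (n : nat) (a b : int) (x y z : rat) :
  trinomial n a b = ('X - x%:P) * ('X - y%:P) * ('X - z%:P) <->
  [/\ x + y + z = 0, x * y + x * z + y * z = b%:~R
    & x * y * z = - a%:~R ^+ n].
Proof.
rewrite cubic_prodE /trinomial; split=> [/polyP e | [-> -> ->]]; last first.
  by rewrite scale0r subr0 polyCN opprK.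
have c i := e i; move: (c 2) (c 1) (c 0); rewrite !(coefE, coefZ) /=.
rewrite ?mulr0 ?mulr1 ?addr0 ?add0r ?subr0 ?sub0r => e2 e1 e0.
by split; [apply/oppr_inj; rewrite -e2 oppr0 | | rewrite e0 opprK].
Qed.

Lemma size_trinomial (n : nat) (a b : int) : size (trinomial n a b) = 4%N.
Proof.
rewrite /trinomial -addrA size_polyDl size_polyXn // ltnS.
apply: leq_trans (size_polyD _ _) _; rewrite geq_max.
rewrite (leq_trans (size_scale_leq _ _)) ?size_polyX //.
by rewrite (leq_trans (size_polyC_leq1 _)).
Qed.

Lemma monic_trinomial (n : nat) (a b : int) : trinomial n a b \is monic.
Proof.
by rewrite monicE lead_coefE size_trinomial trinomial_coefs /= mulr0 !addr0.
Qed.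

Lemma splitting_trinomial_roots (n : nat) (a b : int) :
    is_splitting_field (trinomial n a b) ->
  exists u v w : int,
    [/\ u + v + w = 0, u * v + u * w + v * w = b & u * v * w = - a ^+ n].
Proof.
move=> /(splitting_monic_cubic (monic_trinomial n a b) (size_trinomial n a b)).
move=> [x [y [z /trinomial_eq_prod [e1 e2 e3]]]].
(* By the relations [e1], [e2], [e3] this product expands to t^3 + b t + a^n, so the rational root
   test applies to all three roots at once. *)
have rt t : (t - x) * (t - y) * (t - z) = 0 -> exists u : int, t = u%:~R.
  move=> e; apply: (@rat_root_cubic_int t b (a ^+ n)).
  rewrite -{}e rmorphXn /= -e2 -[_ ^+ n]opprK -e3.
  by rewrite -[z](addKr (x + y)) e1; ring.
have [u xu] : exists u : int, x = u%:~R by apply: rt; ring.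
have [v yv] : exists u : int, y = u%:~R by apply: rt; ring.
have [w zw] : exists u : int, z = u%:~R by apply: rt; ring.
exists u, v, w; rewrite xu yv zw in e1 e2 e3.
split; apply: (@intr_inj rat) => /=.
- by rewrite !rmorphD.
- by rewrite -e2 !(rmorphD, rmorphM).
- by rewrite !rmorphM e3 rmorphN rmorphXn.
Qed.

(** Being an equality, it serves both directions: it derives coprime roots from gcd(a, b) = 1, and
    gcd(a, b) = 1 from coprime roots. *)
Lemma coprimez_trinomial_roots (u v w b : int) :
  u + v + w = 0 -> u * v + u * w + v * w = b -> coprimez u b = coprimez u v.
Proof.
move=> e <-; have -> : w = - (u + v) by lia.
have -> : u * v + u * - (u + v) + v * - (u + v) = (- u - v) * u + - v ^+ 2 by ring.
by rewrite coprimezMDl coprimezN coprimez_pexpr.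
Qed.

Lemma splitting_coprime_fermat (n : nat) (a b : int) :
    (0 < n)%N -> coprimez a b -> 0 < a -> is_splitting_field (trinomial n a b) ->
  exists p q r : int, a = p * q * r /\ coprime_fermat_solution n p q r.
Proof.
move=> n0 ab a0 /splitting_trinomial_roots [u [v [w [s0 eb ea]]]].
have an0 : 0 < a ^+ n by rewrite exprn_gt0.
(* Stated for any ordering of the roots, so that the two positive ones can be put first. *)
have positive_pair x y z : x + y + z = 0 -> x * y + x * z + y * z = b ->
    x * y * z = - a ^+ n -> 0 < x -> 0 < y ->
  exists p q r : int, a = p * q * r /\ coprime_fermat_solution n p q r.
  move=> xyz exb exa x0 y0.
  apply: (@coprimez_sum_prod_eq_exp n x y a) => //; last first.
    by rewrite -[RHS]opprK -exa -[z](addKr (x + y)) xyz; ring.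
  rewrite -(coprimez_trinomial_roots xyz exb).
  have : coprimez (x * y * z) b by rewrite exa coprimeNz coprimez_pexpl.
  by rewrite !coprimezMl => /andP[/andP[]].
have [u0 v0 w0] : [/\ u != 0, v != 0 & w != 0].
  by split; apply: contraTneq an0 => z0; rewrite -oppr_lt0 -ea z0 ?(mul0r, mulr0).
(* Three nonzero roots of equal sign contradict the zero sum. A single positive root makes the
   product positive, against -a^n < 0. *)
have [up|un] := ltP 0 u; have [vp|vn] := ltP 0 v; have [wp|wn] := ltP 0 w.
- lia.
- exact: (positive_pair u v w).
- by apply: (positive_pair u w v) => //; [lia | rewrite -eb; ring | rewrite -ea; ring].
- by exfalso; nia.
- by apply: (positive_pair v w u) => //; [lia | rewrite -eb; ring | rewrite -ea; ring].
- by exfalso; nia.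
- by exfalso; nia.
- lia.
Qed.

Lemma coprime_fermat_splitting (n : nat) (p q r : int) :
    (0 < n)%N -> coprime_fermat_solution n p q r ->
  exists a b : int,
    [/\ a = p * q * r, b != 0, coprimez a b
      & is_splitting_field (trinomial n a b)].
Proof.
move=> n0 [[p0 q0 r0] e [pq pr qr]].
pose u := p ^+ n; pose v := q ^+ n; pose w := - r ^+ n.
have uvw : u + v + w = 0 by rewrite /u /v /w e subrr.
have [b eb] : exists b, u * v + u * w + v * w = b by eexists.
exists (p * q * r), b; split=> //.
- have u0 : 0 < u by rewrite exprn_gt0.
  have v0 : 0 < v by rewrite exprn_gt0.
  have ew : w = - (u + v) by lia.
  (* Here b = -(u^2 + u v + v^2) < 0. *)
  by rewrite -eb ew; nia.
(* Passing to n-th powers turns [p], [q], [r] into the roots up to sign; each root in turn is then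
   taken as the modulus. *)
- rewrite !coprimezMl -[coprimez p b](coprimez_pexpl _ _ n0).
  rewrite -[coprimez q b](coprimez_pexpl _ _ n0) -[coprimez r b](coprimez_pexpl _ _ n0).
  rewrite -/u -/v -[coprimez (r ^+ n) b]coprimeNz -/w.
  rewrite (coprimez_trinomial_roots uvw eb).
  rewrite (@coprimez_trinomial_roots v u w); [|lia|by rewrite -eb; ring].
  rewrite (@coprimez_trinomial_roots w u v); [|lia|by rewrite -eb; ring].
  rewrite /u /v /w coprimeNz !coprimez_pexpl // !coprimez_pexpr // pq.
  by rewrite coprimez_sym pq coprimez_sym pr.
- have -> : trinomial n (p * q * r) b =
      ('X - u%:~R%:P) * ('X - v%:~R%:P) * ('X - w%:~R%:P).
    apply/trinomial_eq_prod; split.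
    + by rewrite -!rmorphD uvw.
    + by rewrite -eb !(rmorphD, rmorphM).
    + by rewrite -rmorphXn -rmorphN -!rmorphM !exprMn mulrN.
  exists [:: 'X - u%:~R%:P; 'X - v%:~R%:P; 'X - w%:~R%:P].
    by move=> g; rewrite !inE => /or3P[] /eqP ->; rewrite size_XsubC.
  by rewrite !big_cons big_nil mulr1 mulrA.
Qed.

Theorem theorem1 (n : nat) (hn : (0 < n)%N) :
  (forall a b : int,
     coprimez a b -> 0 < a -> b != 0 ->
     @is_splitting_field rat (trinomial n a b) ->
     exists p q r : int, a = p * q * r /\ coprime_fermat_solution n p q r) /\
  (forall p q r : int,
     coprime_fermat_solution n p q r ->
     exists a b : int,
       [/\ a = p * q * r, b != 0, coprimez a b
         & @is_splitting_field rat (trinomial n a b)]).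
Proof.
split=> [a b ab a0 _ | p q r].
  exact: splitting_coprime_fermat.
exact: coprime_fermat_splitting.
Qed.
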